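(* Let $n\ge 1$. For integers $0\le k_1<k_2<\cdots<k_n$, the coefficient of $X_1^{k_1}X_2^{k_2}\cdots X_n^{k_n}$ in $$\prod_{i=1}^n\frac{1}{X_i^{n-1}(1-X_i)^n}\prod_{1\le i<j\le n}(X_j-X_i)(1-X_j+X_iX_j),$$ interpreted as a formal Laurent series with $\frac{1}{1-X_i}=\sum_{j\ge0}X_i^j$, is equal to the number of monotone triangles with bottom row $(k_1,\ldots,k_n)$.
   Context: A monotone triangle with $n$ rows is a triangular array of integers $(a_{i,j})_{1\le j\le i\le n}$ such that $a_{i,j}\le a_{i-1,j}\le a_{i,j+1}$ and $a_{i,j}<a_{i,j+1}$ whenever the entries are defined; its bottom row is $(a_{n,1},\ldots,a_{n,n})$. *)

(* Defs.v *)
From HB Require Import structures.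
From mathcomp Require Import all_boot all_order all_algebra finmap.
From mathcomp Require Import mathcomp_extra boolp classical_sets functions.
From mathcomp Require Import cardinality fsbigop.
From mathcomp Require Import zify.

Set Implicit Arguments.
Unset Strict Implicit.
Unset Printing Implicit Defensive.

Import Order.TTheory GRing.Theory Num.Theory.
Local Open Scope classical_set_scope.
Local Open Scope ring_scope.

Lemma ffun_int_bounded (I : finType) (c : {ffun I -> int}) :
  exists K : int, 0 <= K /\ forall i, - K <= c i <= K.
Proof.
exists (\sum_i `|c i|); split=> [|i]; first exact: sumr_ge0.
by rewrite -ler_norml (bigD1 i) //= lerDl sumr_ge0.
Qed.

Lemma finite_box (I : finType) (m M : int) :
  finite_set [set a : {ffun I -> int} | forall i, m <= a i <= M].
Proof.
pose N := `|M - m|%N.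
pose F (u : {ffun I -> 'I_N.+1}) : {ffun I -> int} := [ffun i => m + (u i)%:Z].
apply: (@sub_finite_set _ _ (F @` setT)); last first.
  by apply: finite_image; exact: finite_finset.
move=> a /= amM; exists [ffun i => inord `|a i - m|%N] => //.
apply/ffunP => i; rewrite !ffunE inordK; have := amM i; rewrite /N; lia.
Qed.

Lemma box_fset (I : finType) (m M : int) :
  exists A : {fset {ffun I -> int}},
    forall a : {ffun I -> int}, (forall i, m <= a i <= M) -> a \in A.
Proof.
exists (fset_set [set a : {ffun I -> int} | forall i, m <= a i <= M]) => a am.
by rewrite in_fset_set ?inE //; exact: finite_box.
Qed.

(* A formal Laurent series in n variables with coefficients in R is a family
   of coefficients indexed by the exponent vectors in Z^n, whose support lies
   in a translate of the nonnegative orthant. *)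
Section LaurentSupport.
Variables (R : comNzRingType) (n : nat).
Local Notation E := {ffun 'I_n -> int}.
Implicit Types (f g h : E -> R) (a b c : E) (m : int).

Definition supp_ge m f := forall a, f a != 0 -> forall i, m <= a i.

Definition laurent_bounded f := exists m, supp_ge m f.

Lemma supp_ge_le m m' f : m' <= m -> supp_ge m f -> supp_ge m' f.
Proof. by move=> mm fm a /fm am i; exact: le_trans (am i). Qed.

(* The sum has finite support whenever f and g are Laurent series. *)
Definition convolution f g c : R := \sum_(a \in [set: E]) f a * g (c - a).

Lemma convolutionE f g c (A : {fset E}) :
  (forall a, f a != 0 -> g (c - a) != 0 -> a \in A) ->
  convolution f g c = \sum_(a <- A) f a * g (c - a).
Proof.
move=> HA; rewrite /convolution (fsbigTE A) // => a aA.
case: (eqVneq (f a) 0) => [->|fa]; first by rewrite mul0r.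
case: (eqVneq (g (c - a)) 0) => [->|ga]; first by rewrite mulr0.
by rewrite (HA a fa ga) in aA.
Qed.

Lemma convolution_box m f g c : supp_ge m f -> supp_ge m g ->
  exists A : {fset E}, forall a, f a != 0 -> g (c - a) != 0 -> a \in A.
Proof.
move=> fm gm; have [K [_ cK]] := ffun_int_bounded c.
have [A HA] := box_fset 'I_n m (K - m).
exists A => a /fm fa /gm ga; apply: HA => i.
by have := fa i; have := ga i; have := cK i; rewrite !ffunE;
   move: (a i) (c i) => u v; lia.
Qed.

Lemma supp_ge_convolution m1 m2 f g :
  supp_ge m1 f -> supp_ge m2 g -> supp_ge (m1 + m2) (convolution f g).
Proof.
move=> fm gm c cn0 i; rewrite leNgt; apply/negP => ci; move/eqP: cn0; apply.
apply: fsbig1 => a _.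
case: (eqVneq (f a) 0) => [->|fa]; first by rewrite mul0r.
case: (eqVneq (g (c - a)) 0) => [->|ga]; first by rewrite mulr0.
exfalso; move: ci (fm _ fa i) (gm _ ga i); rewrite !ffunE.
by move: (a i) (c i) => u v; lia.
Qed.

Lemma convolutionC f g : convolution f g = convolution g f.
Proof.
apply/funext => c; rewrite /convolution (reindex_fsbigT (fun a => c - a)).
  by apply: eq_fsbigr => a _; rewrite subKr mulrC.
by exists (fun a => c - a) => a; rewrite subKr.
Qed.

Lemma convolutionDl m f g h : supp_ge m f -> supp_ge m g -> supp_ge m h ->
  convolution (fun a => f a + g a) h
  = (fun a => convolution f h a + convolution g h a).
Proof.
move=> fm gm hm; apply/funext => c.
have fgm : supp_ge m (fun a => f a + g a).
  move=> a; case: (eqVneq (f a) 0) => [->|fa _]; last exact: fm.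
  by rewrite add0r => /gm.
have [A1 H1] := convolution_box c fm hm.
have [A2 H2] := convolution_box c gm hm.
have [A3 H3] := convolution_box c fgm hm.
pose A := (A1 `|` A2 `|` A3)%fset.
rewrite !(@convolutionE _ _ _ A).
- by rewrite -big_split /=; apply: eq_bigr => a _; rewrite mulrDl.
- by move=> a x y; rewrite !inE (H2 a x y) ?orbT.
- by move=> a x y; rewrite !inE (H1 a x y) ?orbT.
- by move=> a x y; rewrite !inE (H3 a x y) ?orbT.
Qed.

Lemma convolutionA m f g h : supp_ge m f -> supp_ge m g -> supp_ge m h ->
  convolution f (convolution g h) = convolution (convolution f g) h.
Proof.
wlog m0 : m / m <= 0 => [wl fm gm hm|fm gm hm].
  have mm : Num.min m 0 <= m by rewrite ge_min lexx.
  apply: (wl (Num.min m 0)); rewrite ?ge_min ?lexx ?orbT //;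
    exact: supp_ge_le mm _.
have ghm := supp_ge_convolution gm hm; have fgm := supp_ge_convolution fm gm.
apply/funext => c; have [K [_ cK]] := ffun_int_bounded c.
have [A HA] := box_fset 'I_n (m + m + m) (K - m - m - m).
rewrite !(@convolutionE _ _ _ A); first last.
- move=> a /fm fa /ghm ga; apply: HA => i.
  by have := fa i; have := ga i; have := cK i; rewrite !ffunE;
   move: (a i) (c i) => u v; lia.
- move=> a /fgm fa /hm ga; apply: HA => i.
  by have := fa i; have := ga i; have := cK i; rewrite !ffunE;
   move: (a i) (c i) => u v; lia.
transitivity (\sum_(d <- A) \sum_(a <- A) f a * g (d - a) * h (c - d)).
  rewrite exchange_big /=; apply: eq_bigr => a _.
  under eq_bigr do rewrite -mulrA.
  rewrite -mulr_sumr; case: (eqVneq (f a) 0) => [->|/fm fa]; rewrite ?mul0r //.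
  congr (_ * _); rewrite /convolution (reindex_fsbigT (fun d => d - a)).
    transitivity (\sum_(d \in [set: E]) g (d - a) * h (c - d)).
      apply: eq_fsbigr => d _; congr (_ * h _).
      by rewrite opprB addrA subrK.
    apply: fsbigTE => d dA.
    case: (eqVneq (g (d - a)) 0) => [->|/gm ga]; first by rewrite mul0r.
    case: (eqVneq (h (c - d)) 0) => [->|/hm hd]; first by rewrite mulr0.
    move/negP: dA; case; apply: HA => i.
    by have := fa i; have := ga i; have := hd i; have := cK i;
       rewrite !ffunE; move: (a i) (c i) (d i) => u v w; lia.
  by exists (fun d => d + a) => d; rewrite ?addrK ?subrK.
apply: eq_bigr => d _; rewrite -mulr_suml.
case: (eqVneq (h (c - d)) 0) => [->|/hm hd]; first by rewrite !mulr0.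
congr (_ * _); rewrite (@convolutionE _ _ _ A) // => a /fm fa /gm ga.
apply: HA => i.
by have := fa i; have := ga i; have := hd i; have := cK i;
   rewrite !ffunE; move: (a i) (c i) (d i) => u v w; lia.
Qed.

Definition monomial_fun b : E -> R := fun a => (a == b)%:R.

Lemma monomial_fun_bounded b : laurent_bounded (monomial_fun b).
Proof.
have [K [_ bK]] := ffun_int_bounded b; exists (- K) => a.
rewrite /monomial_fun; case: (a =P b) => [->|]; last by rewrite eqxx.
by move=> _ i; case/andP: (bK i).
Qed.

Lemma convolution_monomial b f c :
  convolution (monomial_fun b) f c = f (c - b).
Proof.
rewrite (@convolutionE _ _ _ [fset b]%fset).
  by rewrite big_seq_fset1 /monomial_fun eqxx mul1r.
move=> a; rewrite /monomial_fun inE.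
by case: (a == b) => //; rewrite eqxx.
Qed.

End LaurentSupport.

Record laurent (R : comNzRingType) (n : nat) : Type := Laurent {
  lcoef : {ffun 'I_n -> int} -> R;
  lcoef_bounded : laurent_bounded lcoef
}.

Section LaurentRing.
Variables (R : comNzRingType) (n : nat).
Local Notation E := {ffun 'I_n -> int}.
Local Notation L := (laurent R n).
Implicit Types (f g h : L) (a b c : E).

Lemma laurentP f g : (forall a, lcoef f a = lcoef g a) -> f = g.
Proof.
case: f g => [f fb] [g gb] /= fg; have {}fg : f = g by apply/funext.
by case: _ / fg in gb *; congr Laurent; exact: Prop_irrelevance.
Qed.

HB.instance Definition _ := gen_eqMixin L.
HB.instance Definition _ := gen_choiceMixin L.

Lemma laurent_common f g h : exists m : int,
  [/\ supp_ge m (lcoef f), supp_ge m (lcoef g) & supp_ge m (lcoef h)].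
Proof.
have [m1 f1] := lcoef_bounded f; have [m2 g2] := lcoef_bounded g.
have [m3 h3] := lcoef_bounded h.
exists (Num.min m1 (Num.min m2 m3)); split.
- by apply: supp_ge_le f1; rewrite ge_min lexx.
- by apply: supp_ge_le g2; rewrite !ge_min lexx ?orbT.
- by apply: supp_ge_le h3; rewrite !ge_min lexx ?orbT.
Qed.

Fact laurent0_bounded : laurent_bounded (fun _ : E => 0 : R).
Proof. by exists 0 => a; rewrite eqxx. Qed.

Fact laurentN_bounded f : laurent_bounded (fun a => - lcoef f a).
Proof. by have [m fm] := lcoef_bounded f; exists m => a; rewrite oppr_eq0 => /fm. Qed.

Fact laurentD_bounded f g : laurent_bounded (fun a => lcoef f a + lcoef g a).
Proof.
have [m [fm gm _]] := laurent_common f g g; exists m => a.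
case: (eqVneq (lcoef f a) 0) => [->|fa _]; last exact: fm.
by rewrite add0r => /gm.
Qed.

Fact laurentM_bounded f g : laurent_bounded (convolution (lcoef f) (lcoef g)).
Proof.
have [m [fm gm _]] := laurent_common f g g; exists (m + m).
exact: supp_ge_convolution.
Qed.

Definition monomial b : L := Laurent (monomial_fun_bounded R b).
Definition laurent0 : L := Laurent laurent0_bounded.
Definition laurentN f : L := Laurent (laurentN_bounded f).
Definition laurentD f g : L := Laurent (laurentD_bounded f g).
Definition laurentM f g : L := Laurent (laurentM_bounded f g).

Fact laurentDA : associative laurentD.
Proof. by move=> f g h; apply: laurentP => a /=; rewrite addrA. Qed.
Fact laurentDC : commutative laurentD.
Proof. by move=> f g; apply: laurentP => a /=; rewrite addrC. Qed.
Fact laurent0D : left_id laurent0 laurentD.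
Proof. by move=> f; apply: laurentP => a /=; rewrite add0r. Qed.
Fact laurentND : left_inverse laurent0 laurentN laurentD.
Proof. by move=> f; apply: laurentP => a /=; rewrite addNr. Qed.

HB.instance Definition _ :=
  GRing.isZmodule.Build L laurentDA laurentDC laurent0D laurentND.

Fact laurentMA : associative laurentM.
Proof.
move=> f g h; have [m [fm gm hm]] := laurent_common f g h.
by apply: laurentP => a /=; rewrite (convolutionA fm gm hm).
Qed.
Fact laurentMC : commutative laurentM.
Proof. by move=> f g; apply: laurentP => a /=; rewrite convolutionC. Qed.
Fact laurent1M : left_id (monomial 0) laurentM.
Proof.
by move=> f; apply: laurentP => a /=; rewrite convolution_monomial subr0.
Qed.
Fact laurentMDl : left_distributive laurentM +%R.
Proof.
move=> f g h; have [m [fm gm hm]] := laurent_common f g h.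
by apply: laurentP => a /=; rewrite (convolutionDl fm gm hm).
Qed.
Fact laurent1_neq0 : monomial 0 != 0.
Proof.
apply/eqP => /(congr1 (fun f => lcoef f 0)) /= /eqP.
by rewrite /monomial_fun eqxx oner_eq0.
Qed.

HB.instance Definition _ := GRing.Zmodule_isComNzRing.Build L
  laurentMA laurentMC laurent1M laurentMDl laurent1_neq0.

(* On units ^-1 is the inverse of the ring of Laurent series, and on the other
   series it is the identity (the MathComp convention). *)
Definition laurent_unit : pred L := fun f => `[< exists g, g * f = 1 >].

Definition laurent_inv f : L := if pselect (exists g, g * f = 1) is left ex
  then projT1 (cid ex) else f.

Fact laurent_mulVr : {in laurent_unit, left_inverse 1 laurent_inv *%R}.
Proof.
move=> f /asboolP ex; rewrite /laurent_inv; case: pselect => // {}ex.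
by case: cid.
Qed.
Fact laurent_unitPl f g : g * f = 1 -> laurent_unit f.
Proof. by move=> gf; apply/asboolP; exists g. Qed.
Fact laurent_invr_out : {in [predC laurent_unit], laurent_inv =1 id}.
Proof.
move=> f /negP nf; rewrite /laurent_inv; case: pselect => // ex.
by case: nf; apply/asboolP.
Qed.

HB.instance Definition _ := GRing.ComNzRing_hasMulInverse.Build L
  laurent_mulVr laurent_unitPl laurent_invr_out.

Lemma lcoefD f g a : lcoef (f + g) a = lcoef f a + lcoef g a.
Proof. by []. Qed.

Lemma lcoefN f a : lcoef (- f) a = - lcoef f a.
Proof. by []. Qed.

Lemma lcoefM f g a :
  lcoef (f * g) a = \sum_(b \in [set: E]) lcoef f b * lcoef g (a - b).
Proof. by []. Qed.

Lemma lcoef_monomial b a : lcoef (monomial b) a = (a == b)%:R.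
Proof. by []. Qed.

Lemma lcoef_monomialM b f a : lcoef (monomial b * f) a = lcoef f (a - b).
Proof. exact: convolution_monomial. Qed.

Lemma monomialM b c : monomial b * monomial c = monomial (b + c).
Proof.
apply: laurentP => a; rewrite lcoef_monomialM !lcoef_monomial.
by rewrite subr_eq addrC.
Qed.

Definition laurentX (i : 'I_n) : L := monomial [ffun j => (j == i)%:R].

Lemma laurentXV i : (laurentX i)^-1 = monomial (- [ffun j => (j == i)%:R]).
Proof.
have H : monomial (- [ffun j => (j == i)%:R]) * laurentX i = 1.
  by rewrite /laurentX monomialM addNr.
have U : laurentX i \is a GRing.unit.
  by apply/unitrPr; eexists; rewrite mulrC; exact: H.
by apply: (mulIr U); rewrite mulVr.
Qed.

(* The series \sum_(j >= 0) 'X_i ^+ j. *)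
Definition geom_fun (i : 'I_n) : E -> R := fun a =>
  ((0 <= a i) && [forall j, (j != i) ==> (a j == 0)])%:R.

Fact geom_bounded i : laurent_bounded (geom_fun i).
Proof.
exists 0 => a; rewrite /geom_fun; case: andP => [[a0 /forallP aj] _ j|_].
  case: (eqVneq j i) => [->//|ji]; have := aj j.
  by rewrite ji /= => /eqP ->.
by rewrite eqxx.
Qed.

Definition geom i : L := Laurent (geom_bounded i).

Lemma laurent1BX_geom i : (1 - laurentX i) * geom i = 1.
Proof.
rewrite mulrBl mul1r; apply: laurentP => a.
rewrite lcoefD lcoefN lcoef_monomialM /= /geom_fun /monomial_fun.
set P := [forall j, _]; set Q := [forall j, _].
have -> : Q = P.
  apply: eq_forallb => j; case: (eqVneq j i) => //= ji.
  by rewrite !ffunE (negbTE ji) subr0.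
have -> : (a == 0) = (a i == 0) && P.
  apply/eqP/andP => [a0|[/eqP ai /forallP aj]].
    by split; [|apply/forallP => j]; rewrite a0 ffunE eqxx ?implybT.
  apply/ffunP => j; rewrite ffunE; case: (eqVneq j i) => [->//|ji].
  by have := aj j; rewrite ji => /eqP.
rewrite !ffunE eqxx; case: P; rewrite ?andbF ?subr0 // !andbT.
move: (a i) => u; case: (eqVneq u 0) => [->|u0] /=; first by rewrite subr0.
have -> : (0 <= u - 1) = (0 <= u) by apply/idP/idP; move/eqP: u0; lia.
by rewrite subrr.
Qed.

Lemma laurent1BXV i : (1 - laurentX i)^-1 = geom i.
Proof.
have H := laurent1BX_geom i.
have U : 1 - laurentX i \is a GRing.unit by apply/unitrPr; eexists; exact: H.
by apply: (mulrI U); rewrite divrr.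
Qed.

End LaurentRing.

Arguments laurentX {R n} i.

Notation "''X_' i" := (laurentX i)
  (at level 8, i at level 2, format "''X_' i") : ring_scope.

(* Rows and columns are numbered from 0, so that row i has i + 1 entries. *)
Definition cell (n : nat) : Type := {p : 'I_n * 'I_n | (p.2 <= p.1)%N}.

HB.instance Definition _ n := Finite.on (cell n).

Definition row_of n (x : cell n) : 'I_n := (val x).1.
Definition col_of n (x : cell n) : 'I_n := (val x).2.

Definition monotone_triangle n (a : {ffun cell n -> int}) : Prop :=
  forall x y : cell n,
  [/\ row_of x = (row_of y).+1 :> nat -> col_of x = col_of y :> nat ->
        a x <= a y,
      row_of x = (row_of y).+1 :> nat -> col_of x = (col_of y).+1 :> nat ->
        a y <= a x
    & row_of x = row_of y :> nat -> col_of x = (col_of y).+1 :> nat ->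
        a y < a x].

Definition has_bottom_row n (a : {ffun cell n -> int})
    (k : {ffun 'I_n -> int}) : Prop :=
  forall x : cell n, row_of x = n.-1 :> nat -> a x = k (col_of x).

Definition monotone_triangles n (k : {ffun 'I_n -> int}) :
    set {ffun cell n -> int} :=
  [set a | monotone_triangle a /\ has_bottom_row a k].

Lemma monotone_triangles_finite n (k : {ffun 'I_n -> int}) :
  finite_set (monotone_triangles k).
Proof.
have [K [_ kK]] := ffun_int_bounded k.
apply: sub_finite_set (finite_box (cell n) (- K) K) => a [am ak] /= x.
have [d] := ubnP (n - row_of x)%N; elim: d x => // d IH x xd.
have xn := ltn_ord (row_of x).
have [xb|xb] := eqVneq (row_of x : nat) n.-1; first by rewrite ak.
have rn : ((row_of x).+1 < n)%N by lia.
have cr : (col_of x <= row_of x)%N := valP x.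
have cn : ((col_of x).+1 < n)%N by lia.
have p1 : (col_of x <= Ordinal rn)%N by rewrite /=; lia.
have p2 : (Ordinal cn <= Ordinal rn)%N by rewrite /=; lia.
pose y1 : cell n := exist _ (Ordinal rn, col_of x) p1.
pose y2 : cell n := exist _ (Ordinal rn, Ordinal cn) p2.
have [h1 _ _] := am y1 x; have [_ h2 _] := am y2 x.
have d1 : (n - (row_of x).+1 < d)%N by lia.
have /andP[l1 _] := IH y1 d1; have /andP[_ u2] := IH y2 d1.
by rewrite (le_trans l1 (h1 erefl erefl)) (le_trans (h2 erefl erefl) u2).
Qed.

(* Main.v *)
Require Import Defs.
From mathcomp Require Import all_boot all_order all_algebra finmap.
From mathcomp Require Import boolp classical_sets cardinality.
From mathcomp Require Import fingroup perm zify ring.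

(* Multiplication of a generating function by 1 - X_q + X_p X_q acts on its
   coefficients as the operator T_pq = 1 - E_q^-1 + E_p^-1 E_q^-1, E_i being the
   shift in k_i, and the rest of the product is the Vandermonde determinant in
   1 / (1 - X_i). So for k >= 0 the coefficient is
       A_n(k) = (prod_(p < q) T_pq) det (c_j(k_i)),
   with polynomials c_j such that c_0 = 1 and c_(j+1)(x) - c_(j+1)(x - 1)
   = c_j(x).
   For every such sequence c and every strictly increasing k in Z^n, A_n(k) is
   the number of monotone triangles with bottom row k, by induction on n.  Let H
   be A_(n-1) with (c_(j+1)) in place of (c_j).
   - The differences of H in all variables give A_(n-1), so the sum of A_(n-1)
     over the strictly increasing rows interlacing k telescopes into values of H
     at tuples of entries k_i and k_i - 1.
   - T_(i+1,i) H vanishes when two adjacent arguments agree: T_(i+1,i) times the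
     product of all T_pq commutes with the exchange of i and i+1, and the
     determinant is alternating. This cancels all values of H except those
     at (k_1 - 1, ..., k_(i-1) - 1, k_(i+1), ..., k_n), with sign (-1)^(i-1).
   - These are what expanding the determinant of A_n along its column of ones
     produces, because on functions constant in k_i the operator T_pi acts as
     E_p^-1 and T_iq as the identity. *)

Import Order.TTheory GRing.Theory Num.Theory.
Local Open Scope ring_scope.

Set Implicit Arguments.
Unset Strict Implicit.
Unset Printing Implicit Defensive.

(** * Shift operators *)

Definition decr (i : nat) (k : nat -> int) : nat -> int :=
  fun j => k j - (j == i)%:Z.

Lemma decrC i j k : decr i (decr j k) = decr j (decr i k).
Proof. by apply/funext => x; rewrite /decr addrAC. Qed.

Definition backward_diff (i : nat) (f : (nat -> int) -> int) k : int :=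
  f k - f (decr i k).

(* Dual to multiplication by 1 - X_q + X_p X_q on generating functions. *)
Definition twist (p : nat * nat) (f : (nat -> int) -> int) k : int :=
  f k - f (decr p.2 k) + f (decr p.1 (decr p.2 k)).

Definition twists (L : seq (nat * nat)) f := foldr twist f L.

Definition pairs n : seq (nat * nat) :=
  [seq p <- [seq (i, j) | i <- iota 0 n, j <- iota 0 n] | (p.1 < p.2)%N].

Lemma mem_pairs n p : (p \in pairs n) = (p.1 < p.2 < n)%N.
Proof.
rewrite mem_filter; case: p => i j /=; case: (ltnP i j) => //= ij.
apply/allpairsP/idP => [[[x y] /= [_ + [_ ->]]]|jn].
  by rewrite mem_iota.
by exists (i, j); split; rewrite //= mem_iota /=; lia.
Qed.

Lemma uniq_pairs n : uniq (pairs n).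
Proof.
by apply: filter_uniq; apply: allpairs_uniq; rewrite ?iota_uniq //
   => -[? ?] [? ?].
Qed.

Lemma twistC p q f : twist p (twist q f) = twist q (twist p f).
Proof.
apply/funext => k; rewrite /twist.
rewrite (decrC q.2 p.2) (decrC q.2 p.1) (decrC q.2 p.2).
rewrite (decrC q.1 p.2) (decrC q.1 p.1) (decrC q.1 p.2).
ring.
Qed.

Lemma backward_diff_twist i q f :
  backward_diff i (twist q f) = twist q (backward_diff i f).
Proof.
apply/funext => k; rewrite /twist /backward_diff.
rewrite (decrC i q.1) !(decrC i q.2 k); ring.
Qed.

Lemma backward_diff_twists i L f :
  backward_diff i (twists L f) = twists L (backward_diff i f).
Proof. by elim: L => //= p L IH; rewrite backward_diff_twist IH. Qed.

Lemma twist_twists p L f : twist p (twists L f) = twists L (twist p f).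
Proof. by elim: L => //= q L IH; rewrite twistC IH. Qed.

Lemma twists_cat L1 L2 f : twists (L1 ++ L2) f = twists L1 (twists L2 f).
Proof. exact: foldr_cat. Qed.

Lemma twists_comm L1 L2 f : twists L1 (twists L2 f) = twists L2 (twists L1 f).
Proof. by elim: L1 => //= p L1 ->; rewrite twist_twists. Qed.

Lemma perm_twists L1 L2 f : perm_eq L1 L2 -> twists L1 f = twists L2 f.
Proof.
apply: (catCA_perm_subst (F := twists^~ f)) => s1 s2 s3 /=.
by rewrite !twists_cat twists_comm.
Qed.

Lemma twists_sum (I : finType) L (a : I -> int)
    (f : I -> (nat -> int) -> int) k :
  twists L (fun k => \sum_i a i * f i k) k = \sum_i a i * twists L (f i) k.
Proof.
elim: L k => //= p L IH k; rewrite /twist !IH.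
by rewrite -sumrB -big_split; apply: eq_bigr => i _ /=; ring.
Qed.

(** Each occurrence of i in a pair of [L] lowers entry i at most once, so no argument below the
    stated bound is ever evaluated. This allows truncated coefficients to be replaced by
    polynomials. *)
Lemma eq_twists_above L (f g : (nat -> int) -> int) k :
  (forall a : nat -> int,
     (forall i, k i - (count_mem i (unzip1 L) + count_mem i (unzip2 L))%:Z
                <= a i) -> f a = g a) ->
  twists L f k = twists L g k.
Proof.
elim: L k => [|p L IH] k fg /=; first by apply: fg => i; rewrite subr0.
rewrite /twist; congr (_ - _ + _); apply: IH => a ka; apply: fg => i;
  apply: le_trans (ka i); rewrite /decr /= ?[i == _]eq_sym;
  by case: (p.1 == i); case: (p.2 == i) => /=; lia.
Qed.

(** * Symmetry of the twist operators under adjacent exchanges *)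

Definition swap_at (s : nat -> nat) (f : (nat -> int) -> int) k : int :=
  f (k \o s).

Lemma swap_twist s p f : involutive s ->
  swap_at s (twist p f) = twist (s p.1, s p.2) (swap_at s f).
Proof.
move=> sK; have E i k : decr (s i) k \o s = decr i (k \o s).
  by apply/funext => j; rewrite /decr /= (inv_eq sK) sK.
by apply/funext => k; rewrite /swap_at /twist /= !E.
Qed.

Lemma swap_twists s L f : involutive s ->
  swap_at s (twists L f) = twists [seq (s p.1, s p.2) | p <- L] (swap_at s f).
Proof. by move=> sK; elim: L => //= p L IH; rewrite swap_twist ?IH. Qed.

Definition adj_swap i j : nat :=
  if j == i then i.+1 else if j == i.+1 then i else j.

Lemma adj_swapK i : involutive (adj_swap i).
Proof. by move=> j; rewrite /adj_swap; do ![case: eqP => //=]; lia. Qed.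

(** The exchange keeps the order of every pair p < q except (i, i+1), which it trades with the added
    pair (i+1, i). *)
Lemma perm_swap_pairs n i : (i.+1 < n)%N ->
  perm_eq [seq (adj_swap i p.1, adj_swap i p.2) | p <- (i.+1, i) :: pairs n]
    ((i.+1, i) :: pairs n).
Proof.
move=> ni; have sK := adj_swapK i.
have u : uniq ((i.+1, i) :: pairs n).
  by rewrite /= uniq_pairs mem_pairs andbT /=; lia.
apply: uniq_perm => //.
  by rewrite map_inj_uniq // => -[a b] [c d] /=
     [/(inv_inj sK) -> /(inv_inj sK) ->].
move=> [a b].
(* The exchange is an involution, so every pair is the image of its own image and membership is
   tested on the original list. *)
have -> : (a, b) = (adj_swap i (adj_swap i a, adj_swap i b).1,
                  adj_swap i (adj_swap i a, adj_swap i b).2) by rewrite /= !sK.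
rewrite (mem_map (f := fun p => (adj_swap i p.1, adj_swap i p.2))).
  rewrite /= !sK !in_cons !mem_pairs !xpair_eqE /= /adj_swap.
  by do ![case: eqP => /=]; lia.
by move=> [a' b'] [c d] /= [/(inv_inj sK) -> /(inv_inj sK) ->].
Qed.

(** The twisted function changes sign under the exchange of i and i+1, while [k] is fixed by it, so
    the value at [k] is its own negative. *)
Lemma twist_alternating n f i k : (i.+1 < n)%N ->
  (forall a, f (a \o adj_swap i) = - f a) -> k i = k i.+1 ->
  twist (i.+1, i) (twists (pairs n) f) k = 0.
Proof.
move=> ni falt ki; set g := twists ((i.+1, i) :: pairs n) f.
have gk : swap_at (adj_swap i) g k = g k.
  rewrite /swap_at; congr (g _); apply/funext => j /=; rewrite /adj_swap.
  by do ![case: eqP => [->|] //].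
have gN : swap_at (adj_swap i) g = fun a => - g a.
  rewrite swap_twists; last exact: adj_swapK.
  rewrite (perm_twists _ (perm_swap_pairs ni)).
  (* The sign becomes a one-term sum so that the linearity lemma [twists_sum] applies. *)
  have -> : swap_at (adj_swap i) f = fun a => \sum_(j < 1) (-1) * f a.
    by apply/funext => a; rewrite big_ord1 mulN1r; exact: falt.
  apply/funext => a.
  by rewrite (twists_sum _ (fun=> -1) (fun=> f)) big_ord1 mulN1r.
move: gk; rewrite gN /g /= -/g; lia.
Qed.

(** * Twists of functions that are constant in one variable *)

Definition omit (i : nat) (k : nat -> int) : nat -> int := k \o bump i.

Lemma omit_decr i k : omit i (decr i k) = omit i k.
Proof.
apply/funext => j; rewrite /omit /decr /=.
by rewrite eq_sym (negbTE (neq_bump i j)) subr0.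
Qed.

Lemma omit_decr_bump i j k : omit i (decr (bump i j) k) = decr j (omit i k).
Proof.
by apply/funext => x; rewrite /omit /decr /= (inj_eq (can_inj (bumpK i))).
Qed.

Lemma twists_omit i L f :
  twists [seq (bump i p.1, bump i p.2) | p <- L] (f \o omit i)
  = twists L f \o omit i.
Proof.
elim: L => //= p L ->; apply/funext => k.
by rewrite /twist /= !omit_decr_bump.
Qed.

(** On a function constant in k_i, T_iq is 1 - E_q^-1 + E_q^-1 = 1. *)
Lemma twists_right_omit i s f : i \notin s ->
  twists [seq (i, q) | q <- s] (f \o omit i) = f \o omit i.
Proof.
elim: s => //= q s IH; rewrite in_cons negb_or => /andP[iq /IH ->].
apply/funext => k; rewrite /twist /= omit_decr; ring.
Qed.

(** On a function constant in k_i, the first two terms of T_pi cancel and E_p^-1 remains. *)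
Lemma twists_left_omit i s f : i \notin s ->
  twists [seq (p, i) | p <- s] (f \o omit i)
  = fun k => f (omit i (foldr decr k s)).
Proof.
have decrs k t : decr i (foldr decr k t) = foldr decr (decr i k) t.
  by elim: t => //= q t <-; rewrite decrC.
elim: s => //= p s IH; rewrite in_cons negb_or => /andP[ip /IH ->].
apply/funext => k; rewrite /twist /= -!decrs omit_decr.
have decrs' t a : foldr decr (decr p a) t = decr p (foldr decr a t).
  by elim: t => //= q t ->; rewrite decrC.
by rewrite decrs' -decrs decrC omit_decr; ring.
Qed.

Lemma foldr_decr_iota i k :
  foldr decr k (iota 0 i) = fun j => k j - (j < i)%N%:Z.
Proof.
suff H m : foldr decr k (iota m i) = fun j => k j - (m <= j < m + i)%N%:Z.
  by rewrite H; apply/funext => j; rewrite add0n.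
elim: i m => [|i IH] m; apply/funext => j /=; first by rewrite addn0; lia.
by rewrite IH /decr; lia.
Qed.

(** The pairs are grouped by the place of i: second, first or absent; [bump i] renumbers the indices
    of the last group. *)
Lemma perm_pairsS n i : (i <= n)%N ->
  perm_eq (pairs n.+1) ([seq (p, i) | p <- iota 0 i]
    ++ [seq (i, q) | q <- iota i.+1 (n - i)]
    ++ [seq (bump i p.1, bump i p.2) | p <- pairs n]).
Proof.
move=> ni; have bI := can_inj (bumpK i).
have mem1 a b : ((a, b) \in [seq (p, i) | p <- iota 0 i])
    = (a < i)%N && (b == i).
  apply/mapP/andP => [[p + [-> ->]]|[ai /eqP ->]].
    by rewrite mem_iota eqxx.
  by exists a; rewrite ?mem_iota.
have mem2 a b : ((a, b) \in [seq (i, q) | q <- iota i.+1 (n - i)])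
    = (a == i) && (i < b < n.+1)%N.
  apply/mapP/andP => [[p + [-> ->]]|[/eqP -> ib]].
    by rewrite mem_iota eqxx; split=> //; lia.
  by exists b; rewrite ?mem_iota //; lia.
have mem3 a b : ((a, b) \in [seq (bump i p.1, bump i p.2) | p <- pairs n])
    = [&& a != i, b != i & (a < b < n.+1)%N].
  apply/mapP/and3P => [[p + [-> ->]]|[ai bi ab]].
    rewrite mem_pairs /bump; move: (p.1) (p.2) => x y.
    by case: (leqP i x); case: (leqP i y) => ? ? ?; split; lia.
  exists (unbump i a, unbump i b); last by rewrite /= !unbumpK.
  by rewrite mem_pairs /= /unbump; lia.
apply: uniq_perm.
- exact: uniq_pairs.
- rewrite !cat_uniq !map_inj_uniq ?iota_uniq ?uniq_pairs ?andbT /=; first last.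
  + by move=> ? ? [].
  + by move=> ? ? [].
  + by move=> [? ?] [? ?] /= [/bI -> /bI ->].
  apply/andP; split; apply/hasPn => -[a b].
    by rewrite mem_cat mem1 mem2 mem3; lia.
  by rewrite mem2 mem3; lia.
- by move=> [a b]; rewrite !mem_cat mem1 mem2 mem3 mem_pairs /=; lia.
Qed.

Lemma twists_pairs_omit n i f k : (i <= n)%N ->
  twists (pairs n.+1) (f \o omit i) k
  = twists (pairs n) f (omit i (fun j => k j - (j < i)%N%:Z)).
Proof.
move=> ni; rewrite (perm_twists _ (perm_pairsS ni)) !twists_cat twists_omit.
rewrite twists_right_omit; last by rewrite mem_iota; lia.
rewrite twists_left_omit; last by rewrite mem_iota; lia.
by rewrite foldr_decr_iota.
Qed.

(** * Alternants, their expansion and their differences *)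

Definition alternant (c : nat -> int -> int) n (k : nat -> int) : int :=
  \det (\matrix_(i < n, j < n) c j (k i)).

(** When c_j is the backward difference of c_(j+1), this replaces each function by an antidifference
    and leads to the function H. *)
Definition shift_basis (c : nat -> int -> int) : nat -> int -> int :=
  fun j => c j.+1.

Lemma alternant_expand c n k : (forall x, c 0 x = 1) ->
  alternant c n.+1 k
  = \sum_(i < n.+1) (-1) ^+ i * alternant (shift_basis c) n (omit i k).
Proof.
move=> c0; rewrite /alternant (expand_det_col _ ord0); apply: eq_bigr => i _.
rewrite mxE c0 mul1r /cofactor addn0; congr (_ * \det _).
by apply/matrixP => p q; rewrite !mxE.
Qed.

Lemma alternant_swap c n k i : (i.+1 < n)%N ->
  alternant c n (k \o adj_swap i) = - alternant c n k.
Proof.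
move=> ni; pose a : 'I_n := Ordinal (ltnW ni); pose b : 'I_n := Ordinal ni.
have ab : a != b by rewrite -val_eqE /=; lia.
rewrite /alternant -[RHS]mulN1r.
have -> : (-1 : int) = (-1) ^+ (tperm a b) by rewrite odd_tperm ab.
rewrite -det_perm -det_mulmx -row_permE; congr (\det _).
apply/matrixP => p q; rewrite !mxE /= ; congr (c _ (k _)).
rewrite permE /= /adj_swap -!val_eqE /=.
by case: eqP => // _; case: eqP.
Qed.

(** The difference in k_i touches row i only; by multilinearity it turns c_(j+1) into c_j there. The
    rows from m on are those already treated. *)
Lemma backward_diff_alternant_from c n m r : (m + r = n)%N ->
  (forall j x, c j.+1 x - c j.+1 (x - 1) = c j x) ->
  foldr backward_diff (alternant (shift_basis c) n) (iota m r)
  = fun k => \det (\matrix_(i < n, j < n)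
                     if (i < m)%N then c j.+1 (k i) else c j (k i)).
Proof.
move=> mr cS; elim: r m mr => [|r IH] m mr /=; apply/funext => k.
  rewrite /alternant; congr (\det _); apply/matrixP => i j.
  by rewrite !mxE -[m]addn0 mr ltn_ord.
rewrite (IH m.+1) ?addSnnS // /backward_diff.
have mn : (m < n)%N by lia.
(* The coefficients 1 and -1 are made explicit, as [determinant_multilinear] requires. *)
symmetry; rewrite -[X in _ = X - _]mul1r -[X in _ = _ - X]mul1r -mulNr.
apply: (determinant_multilinear (i0 := Ordinal mn)).
- apply/rowP => j; rewrite !mxE /= ltnn ltnSn mul1r mulN1r.
  by rewrite /decr eqxx -(cS j).
- by apply/matrixP => i j; rewrite !mxE /=; have := neq_lift (Ordinal mn) i;
    rewrite -val_eqE /= ltnS leq_eqVlt eq_sym => /negbTE ->.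
- apply/matrixP => i j; rewrite !mxE /=; have := neq_lift (Ordinal mn) i.
  rewrite -val_eqE /= ltnS leq_eqVlt eq_sym /decr => /negbTE ->.
  by rewrite subr0.
Qed.

Lemma backward_diff_alternant c n :
  (forall j x, c j.+1 x - c j.+1 (x - 1) = c j x) ->
  foldr backward_diff (alternant (shift_basis c) n) (iota 0 n) = alternant c n.
Proof.
move=> cS; rewrite (backward_diff_alternant_from (add0n n) cS).
by apply/funext => k; congr (\det _); apply/matrixP => i j; rewrite !mxE.
Qed.

(** * Sums over interlacing rows *)

Definition int_range (a b : int) : seq int :=
  [seq a + i%:Z | i <- iota 0 `|b - a|%N].

Lemma mem_int_range a b x : a <= b -> (x \in int_range a b) = (a <= x < b).
Proof.
move=> ab; apply/mapP/idP => [[i + ->]|xab]; first by rewrite mem_iota; lia.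
by exists `|x - a|%N; rewrite ?mem_iota; lia.
Qed.

Lemma int_range_uniq a b : uniq (int_range a b).
Proof. by rewrite map_inj_uniq ?iota_uniq // => i j; lia. Qed.

Lemma telescope_int_range (f : int -> int) a b : a <= b ->
  \sum_(x <- int_range a b) (f x - f (x - 1)) = f (b - 1) - f (a - 1).
Proof.
move=> ab; rewrite big_map -[X in iota 0 X]subn0 -/(index_iota 0 _).
pose g i := f (a + i%:Z - 1).
rewrite (eq_bigr (fun i => g i.+1 - g i)); last first.
  by move=> i _; rewrite /g; congr (f _ - f _); lia.
by rewrite telescope_sumr // /g; congr (f _ - f _); lia.
Qed.

(* The strictly increasing w with a <= w_0 <= s_0 <= w_1 <= s_1 <= ... *)
Fixpoint interlacing (a : int) (s : seq int) : seq (seq int) :=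
  if s is b :: s' then
    [seq x :: w | x <- int_range a b, w <- interlacing b s']
      ++ [seq b :: w | w <- interlacing (b + 1) s']
  else [:: [::]].

(** A first entry below b leaves b as lower bound of the next one; the entry b itself raises that
    bound to b + 1, which is how strictness enters. *)
Lemma sum_interlacing_cons (f : seq int -> int) a b s :
  \sum_(w <- interlacing a (b :: s)) f w
  = \sum_(x <- int_range a b) \sum_(w <- interlacing b s) f (x :: w)
    + \sum_(w <- interlacing (b + 1) s) f (b :: w).
Proof. by rewrite big_cat big_allpairs_dep big_map. Qed.

(** The difference in all variables, phrased on lists to follow the recursion of [interlacing]. *)
Fixpoint multi_diff (w : seq int) (H : seq int -> int) : int :=
  if w is x :: w' then multi_diff w' (fun v => H (x :: v) - H (x - 1 :: v))
  else H [::].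

Lemma eq_multi_diff w H H' : H =1 H' -> multi_diff w H = multi_diff w H'.
Proof.
by elim: w H H' => [|x w IH] H H' HH /=; [|apply: IH => v]; rewrite !HH.
Qed.

(** The alternating sum over the entry deleted from [a :: s], the entries before it being lowered by
    1; [skip_sumE] gives the closed form. *)
Fixpoint skip_sum (a : int) (s : seq int) (H : seq int -> int) : int :=
  if s is b :: s' then H s - skip_sum b s' (fun w => H (a - 1 :: w))
  else H [::].

Lemma eq_skip_sum a s H H' : (forall v, size v = size s -> H v = H' v) ->
  skip_sum a s H = skip_sum a s H'.
Proof.
elim: s a H H' => [|b s IH] a H H' HH /=; first exact: HH.
rewrite HH // (IH _ _ (fun v => H' (a - 1 :: v))) // => v sv.
by rewrite HH //= sv.
Qed.

Lemma skip_sumB a s H H' :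
  skip_sum a s (fun v => H v - H' v) = skip_sum a s H - skip_sum a s H'.
Proof. by elim: s a H H' => //= b s IH a H H'; rewrite IH; ring. Qed.

(** Over the integers, [path <%R (a - 1) s] only asks that a be at most the head of s. This weak
    bound is what survives when [interlacing] restarts at b + 1. *)
Lemma path_lt_pred (a : int) (s : seq int) :
  path <%R a s -> path <%R (a - 1) s.
Proof. by case: s => //= b s /andP[ab ->]; rewrite andbT; lia. Qed.

(* The hypothesis on H cancels the boundary terms in which some entry of the
   row s is used both as an upper and as a lower summation bound. *)
Lemma sum_multi_diff (a : int) (s : seq int) (H : seq int -> int) :
  path <%R (a - 1) s ->
  (forall p x q, (size p + size q).+2 = size s ->
     H (p ++ x :: x :: q) - H (p ++ x - 1 :: x :: q)
     + H (p ++ x - 1 :: x - 1 :: q) = 0) ->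
  \sum_(w <- interlacing a s) multi_diff w H = skip_sum a s H.
Proof.
elim: s a H => [|b s IH] a H; first by rewrite big_seq1.
move=> /= /andP[ab bs] van; rewrite sum_interlacing_cons /=.
have bs1 := path_lt_pred bs.
have bs2 : path <%R (b + 1 - 1) s by rewrite addrK.
(* The boundary condition passes to differences in the first variable: subtract its instances with x
   and x - 1 in front. *)
have van' x : forall p y q, (size p + size q).+2 = size s ->
   (H (x :: p ++ y :: y :: q) - H (x - 1 :: p ++ y :: y :: q))
   - (H (x :: p ++ y - 1 :: y :: q) - H (x - 1 :: p ++ y - 1 :: y :: q))
   + (H (x :: p ++ y - 1 :: y - 1 :: q)
      - H (x - 1 :: p ++ y - 1 :: y - 1 :: q)) = 0.
  move=> p y q pq; have := van (x :: p) y q; have := van (x - 1 :: p) y q.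
  by rewrite /= addSn pq => /(_ erefl) + /(_ erefl); lia.
(* By induction the inner sum is the backward difference of G, so the sum over x < b telescopes. *)
pose G x := skip_sum b s (fun v => H (x :: v)).
rewrite (eq_bigr (fun x => G x - G (x - 1))); last first.
  by move=> x _; rewrite -skip_sumB IH //; exact: van'.
rewrite telescope_int_range /G; last by lia.
rewrite (IH (b + 1) (fun v => H (b :: v) - H (b - 1 :: v)) bs2 (van' b)).
rewrite skip_sumB.
(* The term G (a - 1) is already the tail of [skip_sum a (b :: s) H]; everything else has to
   collapse to H (b :: s). *)
suff : skip_sum b s (fun v => H (b - 1 :: v))
     + skip_sum (b + 1) s (fun v => H (b :: v))
     - skip_sum (b + 1) s (fun v => H (b - 1 :: v)) = H (b :: s).
  by move=> <-; ring.
clear G; case: s van {IH bs bs1 bs2 van'} => [|c s] van /=; first by lia.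
rewrite !addrK.
(* The remaining inner sums start with b, b or b - 1, b or b - 1, b - 1; the boundary condition with
   empty [p] cancels them. *)
have : skip_sum c s (fun w => H [:: b, b & w] - H [:: b - 1, b & w])
       = skip_sum c s (fun w => 0 - H [:: b - 1, b - 1 & w]).
  apply: eq_skip_sum => w sw; have := van [::] b w; rewrite /= sw.
  by move=> /(_ erefl); lia.
rewrite !skip_sumB.
have -> : skip_sum c s (fun=> 0) = 0.
  by have := skip_sumB c s (fun=> 0) (fun=> 0); rewrite subr0 subrr.
by rewrite sub0r => /(canRL (subrK _)) ->; ring.
Qed.

Lemma mem_interlacing (a : int) (s w : seq int) : path <%R (a - 1) s ->
  w \in interlacing a s <->
  [/\ size w = size s, sorted <%R w
    & forall i, (i < size s)%N -> nth 0 (a :: s) i <= nth 0 w i <= nth 0 s i].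
Proof.
elim: s a w => [|b s IH] a w /=.
  by move=> _; rewrite inE; split=> [/eqP -> //|[/size0nil ->]].
move=> /andP[ab bs].
have bs1 := path_lt_pred bs.
have bs2 : path <%R (b + 1 - 1) s by rewrite addrK.
have abs : (a <= b) by lia.
rewrite mem_cat; split.
  case/orP=> [/allpairsP[[x v] /= [xab /(IH _ _ bs1)[sv pv bv] ->]]|].
    move: xab; rewrite mem_int_range // => xab; split; rewrite /= ?sv //.
      by case: v s sv pv bv {IH bs bs1 bs2} => [|y v] [|c s] //= _ ->
        /(_ 0 isT) /=; lia.
    by move=> [|i] /= si; [lia|apply: bv].
  case/mapP => v /(IH _ _ bs2)[sv pv bv] ->; split; rewrite /= ?sv //.
    by case: v s sv pv bv {IH bs bs1 bs2} => [|y v] [|c s] //= _ ->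
        /(_ 0 isT) /=; lia.
  by case=> [|i] /= si; [lia|have := bv i si; case: i si => //= _; lia].
case: w => [|x w] [] //= [sw] pw bw.
have /= /andP[ax xb] := bw 0 isT.
have [xb1|xb1] := boolP (x < b).
  apply/orP; left; apply/allpairsP; exists (x, w) => /=.
  split=> //; first by rewrite mem_int_range //; lia.
  apply/(IH _ _ bs1); split=> //; first exact: path_sorted pw.
  by move=> i si; exact: (bw i.+1).
have {xb xb1} xb : x = b by lia.
(* After the entry b, strict increase puts the next entry at b + 1 or above, as the second branch
   demands. *)
apply/orP; right; rewrite xb; apply: map_f; apply/(IH _ _ bs2); split=> //.
  exact: path_sorted pw.
case=> [|i] /= si; last exact: (bw i.+2).
have := bw 1 si; move: pw; rewrite xb.
by case: w sw {bw} => [|y w] /=; [lia|move=> _ /andP[]; lia].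
Qed.

Lemma interlacing_uniq a s : uniq (interlacing a s).
Proof.
elim: s a => //= b s IH a; rewrite cat_uniq; apply/and3P; split.
- by apply: allpairs_uniq; rewrite ?int_range_uniq //
  => -[? ?] [? ?] _ _ [-> ->].
- apply/hasPn => w /mapP[v _ ->]; apply/negP => /allpairsP[[x u] /= [+ _ [bx]]].
  by rewrite -bx => /mapP[i]; rewrite mem_iota; lia.
- by rewrite map_inj_uniq // => ? ? [].
Qed.

Definition fcons (x : int) (k : nat -> int) : nat -> int :=
  fun j => if j is i.+1 then k i else x.

Lemma nth_fcons x s : nth 0 (x :: s) = fcons x (nth 0 s).
Proof. by apply/funext => -[]. Qed.

(** The term produced at depth i deletes entry i; each earlier level contributes a sign and an entry
    lowered by 1. *)
Lemma skip_sumE a s (h : (nat -> int) -> int) :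
  skip_sum a s (fun w => h (nth 0 w))
  = \sum_(i < (size s).+1)
      (-1) ^+ i * h (omit i (fun j => nth 0 (a :: s) j - (j < i)%N%:Z)).
Proof.
have om0 x t : omit 0 (fun j => nth 0 (x :: t) j - (j < 0)%N%:Z) = nth 0 t.
  by apply/funext => j; rewrite /omit /= subr0.
elim: s a h => [|b s IH] a h; first by rewrite big_ord1 mul1r om0.
rewrite /= big_ord_recl om0 mul1r; congr (_ + _).
under eq_skip_sum => v _ do rewrite nth_fcons.
rewrite (IH b (fun k => h (fcons (a - 1) k))) -sumrN.
apply: eq_bigr => i _; rewrite /= exprS mulN1r mulNr; congr (- (_ * h _)).
by apply/funext => -[|j] //=; rewrite /omit /= bumpS.
Qed.

Lemma backward_diffC i j f :
  backward_diff i (backward_diff j f) = backward_diff j (backward_diff i f).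
Proof. by apply/funext => k; rewrite /backward_diff (decrC i); ring. Qed.

Lemma nth_decr (p : seq int) (x : int) (q : seq int) :
  nth 0 (p ++ x - 1 :: q) = decr (size p) (nth 0 (p ++ x :: q)).
Proof.
apply/funext => j; rewrite /decr !nth_cat.
case: ltngtP => jp; rewrite ?subr0 //; last by rewrite jp subnn.
by rewrite -(subnSK jp).
Qed.

Lemma multi_diffE w f :
  multi_diff w (fun v => f (nth 0 v))
  = foldr backward_diff f (iota 0 (size w)) (nth 0 w).
Proof.
(* The prefix [p] holds the entries already passed, so the positions start at [size p]. *)
suff H p : multi_diff w (fun v => f (nth 0 (p ++ v)))
    = foldr backward_diff f (iota (size p) (size w)) (nth 0 (p ++ w)).
  exact: (H [::]).
elim: w p f => [|x w IH] p f //=.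
have comm i L g : backward_diff i (foldr backward_diff g L)
                = foldr backward_diff (backward_diff i g) L.
  by elim: L => //= j L <-; rewrite backward_diffC.
rewrite comm -cat_rcons -(size_rcons p x) -IH; apply: eq_multi_diff => v.
by rewrite /backward_diff cat_rcons -nth_decr.
Qed.

(** * Recursion for the twisted determinant A_n *)

Definition row_poly c (s : seq int) : int :=
  twists (pairs (size s)) (alternant c (size s)) (nth 0 s).

Lemma row_poly_recursion c a s : (forall x, c 0 x = 1) ->
  row_poly c (a :: s)
  = skip_sum a s (fun w => twists (pairs (size s))
                    (alternant (shift_basis c) (size s)) (nth 0 w)).
Proof.
move=> c0; rewrite /row_poly skip_sumE.
have -> : alternant c (size s).+1 = fun k => \sum_(i < (size s).+1) (-1) ^+ i *
   (alternant (shift_basis c) (size s) \o omit i) k.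
  by apply/funext => k; exact: alternant_expand.
rewrite twists_sum; apply: eq_bigr => i _.
by rewrite twists_pairs_omit //; case: i => /= i; rewrite ltnS.
Qed.

(** The three values form T_(i+1,i) with i = [size p], applied where entries i and i+1 are both
    x. *)
Lemma twists_alternant_boundary c (p : seq int) (x : int) (q : seq int) n :
  (size p + size q).+2 = n ->
  let H w := twists (pairs n) (alternant c n) (nth 0 w) in
  H (p ++ x :: x :: q) - H (p ++ x - 1 :: x :: q)
     + H (p ++ x - 1 :: x - 1 :: q) = 0.
Proof.
move=> pqn H.
rewrite /H -(cat_rcons (x - 1) p (x - 1 :: q)) (nth_decr (rcons _ _)).
rewrite size_rcons cat_rcons.
rewrite nth_decr; apply: (@twist_alternating n); first by lia.
  by move=> a; apply: alternant_swap; lia.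
by rewrite !nth_cat ltnn ltnNge leqnSn /= subnn subSnn.
Qed.

Fixpoint num_monotone n (s : seq int) : int :=
  if n is n'.+1 then
    \sum_(w <- interlacing (head 0 s) (behead s)) num_monotone n' w
  else 1.

Lemma num_monotoneE c n s : (forall x, c 0 x = 1) ->
  (forall j x, c j.+1 x - c j.+1 (x - 1) = c j x) ->
  size s = n -> sorted <%R s -> num_monotone n s = row_poly c s.
Proof.
move=> c0 cS; elim: n s => [|n IH] [|a s] //=.
  by move=> _ _; rewrite /row_poly /= /alternant det_mx00.
move=> [sn] as_.
have as1 := path_lt_pred as_.
rewrite row_poly_recursion // -sum_multi_diff //; last first.
  by move=> p x q; exact: twists_alternant_boundary.
apply: eq_big_seq => w ws.
have [sw pw _] := (mem_interlacing w as1).1 ws.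
rewrite IH //; last by rewrite sw.
(* A_(n-1) is the total difference of H, because differences commute with twists and turn the
   shifted alternant into the alternant of [c]. *)
rewrite multi_diffE /row_poly sw.
rewrite -[alternant c _](backward_diff_alternant _ cS).
suff E L f : foldr backward_diff (twists (pairs n) f) L
           = twists (pairs n) (foldr backward_diff f L) by rewrite sn E.
by elim: L => //= i L ->; rewrite backward_diff_twists.
Qed.

(** * Enumeration of monotone triangles *)

Lemma cell_inj n (x y : cell n) :
  row_of x = row_of y :> nat -> col_of x = col_of y :> nat -> x = y.
Proof.
case: x y => [[i j] ij] [[i' j'] ij'] /val_inj /= rr /val_inj cc.
by apply: val_inj; congr (_, _).
Qed.

Lemma cellP n i j : (j <= i < n)%N ->
  exists x : cell n, row_of x = i :> nat /\ col_of x = j :> nat.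
Proof.
move=> /andP[ji i_n]; have jn := leq_ltn_trans ji i_n.
by exists (exist _ (Ordinal i_n, Ordinal jn) ji).
Qed.

(** Indexing by natural numbers avoids the bounds carried by cells; outside the triangle the value
    is 0. *)
Definition entry n (a : {ffun cell n -> int}) (i j : nat) : int :=
  if [pick x : cell n | (row_of x == i :> nat) && (col_of x == j :> nat)]
    is Some x
  then a x else 0.

Lemma entryE n (a : {ffun cell n -> int}) x :
  entry a (row_of x) (col_of x) = a x.
Proof.
rewrite /entry; case: pickP => [y /andP[/eqP rr /eqP cc]|/(_ x)].
  by rewrite (cell_inj rr cc).
by rewrite !eqxx.
Qed.

Definition array n (t : nat -> nat -> int) : {ffun cell n -> int} :=
  [ffun x => t (row_of x) (col_of x)].

Lemma entry_array n t i j : (j <= i < n)%N -> entry (array n t) i j = t i j.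
Proof. by move=> /cellP[x [<- <-]]; rewrite entryE ffunE. Qed.

Lemma entryP n (a b : {ffun cell n -> int}) :
  (forall i j, (j <= i < n)%N -> entry a i j = entry b i j) -> a = b.
Proof.
move=> ab; apply/ffunP => x; rewrite -!entryE ab //.
by rewrite (valP x) ltn_ord.
Qed.

Lemma monotone_triangleP n (a : {ffun cell n -> int}) :
  monotone_triangle a <-> forall i j, (i < n)%N ->
    ((j <= i)%N -> (i.+1 < n)%N ->
       entry a i.+1 j <= entry a i j <= entry a i.+1 j.+1) /\
    ((j < i)%N -> entry a i j < entry a i j.+1).
Proof.
have E (x : cell n) i j : row_of x = i :> nat -> col_of x = j :> nat ->
    entry a i j = a x by move=> <- <-; exact: entryE.
split=> [mt i j i_n|mt x y].
  split=> ji => [i1n|].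
    have [|y [ry cy]] := @cellP n i j; first by rewrite ji.
    have [|x1 [rx1 cx1]] := @cellP n i.+1 j; first by rewrite leqW.
    have [|x2 [rx2 cx2]] := @cellP n i.+1 j.+1; first by rewrite ltnS ji.
    rewrite (E _ _ _ ry cy) (E _ _ _ rx1 cx1) (E _ _ _ rx2 cx2).
    have [m1 _ _] := mt x1 y; have [_ m2 _] := mt x2 y.
    by rewrite m1 ?m2 // ?rx1 ?rx2 ?cx1 ?cx2 ?ry ?cy.
  have [|y [ry cy]] := @cellP n i j; first by rewrite ltnW.
  have [|x [rx cx]] := @cellP n i j.+1; first by rewrite ji.
  rewrite (E _ _ _ ry cy) (E _ _ _ rx cx).
  by have [_ _] := mt x y; apply; rewrite ?rx ?cx ?ry ?cy.
rewrite -!entryE; have := valP x; have := valP y.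
rewrite -/(row_of x) -/(row_of y) -/(col_of x) -/(col_of y).
have [] := mt (row_of y) (col_of y) (ltn_ord _).
move: (ltn_ord (row_of x)) => xn m1 m2 ly lx.
split=> [rr cc|rr cc|rr cc]; rewrite rr cc in xn lx *.
- by case/andP: (m1 ly xn).
- by case/andP: (m1 ly xn).
- by apply: m2; lia.
Qed.

Lemma has_bottom_rowP n (a : {ffun cell n -> int}) (k : {ffun 'I_n -> int}) :
  has_bottom_row a k <-> forall j : 'I_n, entry a n.-1 j = k j.
Proof.
split=> [bk j|bk x xn]; last by rewrite -entryE xn bk.
have [|x [rx cx]] := @cellP n n.-1 j; first by have := ltn_ord j; lia.
by rewrite -rx -cx entryE bk //; congr (k _); exact: val_inj.
Qed.

Definition append_row n (a : {ffun cell n -> int}) (s : seq int) :=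
  array n.+1 (fun i j => if i == n then nth 0 s j else entry a i j).

(** The enumeration mirrors the recursion of [num_monotone], so that the two counts agree by
    construction. *)
Fixpoint triangles n (s : seq int) : seq {ffun cell n -> int} :=
  if n is n'.+1 return seq {ffun cell n -> int} then
    [seq append_row a s | w <- interlacing (head 0 s) (behead s),
                          a <- triangles n' w]
  else [:: [ffun=> 0]].

Lemma size_triangles n s : (size (triangles n s))%:Z = num_monotone n s.
Proof.
elim: n s => //= n IH s; rewrite size_allpairs_dep sumnE big_map.
by rewrite -natz natr_sum; apply: eq_bigr => w _; rewrite natz IH.
Qed.

Lemma mem_triangles n s a : size s = n -> sorted <%R s ->
  a \in triangles n s <->
  monotone_triangle a /\ (forall j, (j < n)%N -> entry a n.-1 j = nth 0 s j).
Proof.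
elim: n s a => [|n IH] [|h s] a //=.
  move=> _ _; rewrite inE; split=> [/eqP ->|_].
    by split=> // x; have := ltn_ord (row_of x); rewrite ltn0.
  by apply/eqP/ffunP => x; have := ltn_ord (row_of x); rewrite ltn0.
move=> [sn] hs.
have hs1 := path_lt_pred hs.
have s_incr i : (i < n)%N -> nth 0 (h :: s) i < nth 0 (h :: s) i.+1.
  by rewrite -sn => si; move/(sortedP 0): (hs : sorted <%R (h :: s)); apply.
set t := h :: s in s_incr *.
split=> [/allpairsPdep[w [b [/(mem_interlacing _ hs1)[sw pw bw] + ->]]]|].
  rewrite sn in sw bw; move=> /(IH _ _ sw pw)[/monotone_triangleP mb botb].
  split; last by move=> j jn; rewrite entry_array ?eqxx // leqnn andbT -ltnS.
  apply/monotone_triangleP => i j; rewrite ltnS => i_n; split=> ji => [i1n|].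
    have [m1 _] := mb i j (i1n : (i < n)%N); have := m1 ji.
    rewrite !entry_array; try lia.
    have -> : (i == n) = false by lia.
    case: eqVneq => [e _|ne]; last by apply; lia.
    have -> : i = n.-1 by lia.
    by rewrite botb; [apply: bw|]; lia.
  rewrite !entry_array; try lia.
  case: eqVneq => [e|ne]; first by apply: s_incr; rewrite -e.
  by have [|_] := mb i j; [lia|apply].
move=> [/monotone_triangleP ma bota].
(* The row just above the bottom one, and the array without its bottom row; both are empty for n =
   0. *)
pose w := mkseq (entry a n.-1) n; pose b := array n (entry a).
have sw : size w = n by rewrite size_mkseq.
have pw : sorted <%R w.
  apply/(sortedP 0) => i; rewrite sw => i_n.
  by rewrite !nth_mkseq ?(ltnW i_n) //; apply: (ma n.-1 i _).2; lia.
apply/allpairsPdep; exists w, b; split.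
- apply/(mem_interlacing _ hs1); rewrite sn; split=> // i i_n.
  rewrite nth_mkseq //; have [|m1 _] := ma n.-1 i; first by lia.
  have e : n.-1.+1 = n by lia.
  by move: m1; rewrite e !bota ?ltnS //; [apply; lia|lia].
- apply/(IH _ _ sw pw); split; last first.
    by move=> j jn; rewrite entry_array ?nth_mkseq //; lia.
  apply/monotone_triangleP => i j i_n.
  have [|m1 m2] := ma i j; first by lia.
  by split=> ji => [i1n|]; rewrite !entry_array; lia.
- apply: entryP => i j ijn; rewrite entry_array //.
  by case: eqVneq => [->|ne]; [apply: bota|rewrite entry_array]; lia.
Qed.

(** The extended array determines the smaller triangle, whose bottom row in turn determines [w]. *)
Lemma triangles_uniq n s : size s = n -> sorted <%R s -> uniq (triangles n s).
Proof.
elim: n s => [|n IH] [|h s] //= [sn] hs.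
have hs1 := path_lt_pred hs.
have wP w : w \in interlacing h s -> size w = n /\ sorted <%R w.
  by case/(mem_interlacing _ hs1) => -> pw _.
apply: allpairs_uniq_dep => [|w /wP[sw pw]|]; first exact: interlacing_uniq.
  exact: IH.
move=> p q /allpairsPdep[w [a [/wP[sw pw] aw ->]]]
  /allpairsPdep[v [b [/wP[sv pv] bv ->]]] /= ab.
have {}ab : a = b.
  apply: entryP => i j ijn; have := congr1 (fun c => entry c i j) ab.
  rewrite /= !entry_array; try lia.
  by have -> : (i == n) = false by lia.
move: aw bv => /(mem_triangles _ sw pw)[_ aw] /(mem_triangles _ sv pv)[_ bv].
suff -> : w = v by rewrite ab.
by apply: (@eq_from_nth _ 0) => [|i]; rewrite sw // => i_n;
   rewrite -aw // -bv ?ab.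
Qed.

Lemma card_monotone_triangles n (k : {ffun 'I_n -> int}) (s : seq int) :
  size s = n -> sorted <%R s -> (forall i : 'I_n, nth 0 s i = k i) ->
  (#|` fset_set (monotone_triangles k)|)%fset%:Z = num_monotone n s.
Proof.
move=> sn ss sk; rewrite -size_triangles -(undup_id (triangles_uniq sn ss)).
rewrite -card_fseq; congr (Posz #|` _|)%fset; apply/fsetP => a.
rewrite in_fset_set; last exact: monotone_triangles_finite.
rewrite in_fset -[in RHS]topredE /= -[RHS]/(a \in triangles n s).
apply/idP/idP => [/set_mem[ma /has_bottom_rowP ba]|].
  apply/(mem_triangles _ sn ss); split=> // j jn.
  by rewrite (ba (Ordinal jn)) -sk.
move/(mem_triangles _ sn ss) => [ma ba]; apply/mem_set; split=> //.
by apply/has_bottom_rowP => j; rewrite ba // sk.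
Qed.

(** * Coefficients of Laurent series *)

(** Index i meets each of the n other indices once, so the twists lower an entry by at most n. *)
Lemma count_pairs n i : (i <= n)%N ->
  (count_mem i (unzip1 (pairs n.+1)) + count_mem i (unzip2 (pairs n.+1)) = n)%N.
Proof.
move=> ni; have pe := perm_pairsS ni.
rewrite !count_map !(seq.permP pe) !count_cat !count_map.
have zero (T : eqType) (P : pred T) r : (forall x, x \in r -> ~~ P x) ->
    count P r = 0%N.
  by move=> Pr; apply/eqP; rewrite -leqn0 leqNgt -has_count; apply/hasPn.
have one (P : pred nat) r : (forall x, P x) -> count P r = size r.
  by move=> Pr;
     rewrite (eq_count (a2 := predT)) ?count_predT // => x; rewrite Pr.
(* First coordinates over the three groups of pairs, then second coordinates: each time i fills
   exactly one group. *)
rewrite zero => [|x /=]; last by rewrite mem_iota; lia.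
rewrite one => [|x /=]; last by rewrite eqxx.
rewrite zero => [|x _ /=]; last by rewrite eq_sym neq_bump.
rewrite one => [|x /=]; last by rewrite eqxx.
rewrite zero => [|x /=]; last by rewrite mem_iota; lia.
rewrite zero => [|x _ /=]; last by rewrite eq_sym neq_bump.
by rewrite !size_iota; lia.
Qed.

(* The polynomial (x + 1) ... (x + j) / j!, also at negative x. *)
Definition rising_binomial (j : nat) (x : int) : int :=
  match x with
  | Posz m => 'C(m + j, j)%:Z
  | Negz m => (-1) ^+ j * 'C(m, j)%:Z
  end.

Lemma rising_binomial0 x : rising_binomial 0 x = 1.
Proof. by case: x => m /=; rewrite bin0. Qed.

Lemma rising_binomialS j x :
  rising_binomial j.+1 x - rising_binomial j.+1 (x - 1) = rising_binomial j x.
Proof.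
case: x => [[|m]|m].
- by rewrite /= !binn bin0n mulr0 subr0.
- have -> : m.+1%:Z - 1 = m by lia.
  by rewrite /= addSn binS -!addSnnS PoszD; ring.
- have -> : Negz m - 1 = Negz m.+1 by lia.
  by rewrite /= binS exprS PoszD; ring.
Qed.

Section LaurentCoefficients.
Variable n : nat.
Local Notation L := (laurent int n).
Local Notation E := {ffun 'I_n -> int}.
Implicit Types (f g : L) (a b : E).

Lemma lcoef_sum (I : finType) (F : I -> L) a :
  lcoef (\sum_i F i) a = \sum_i lcoef (F i) a.
Proof.
exact: (big_morph (fun f => lcoef f a) (fun f g => lcoefD f g a) erefl).
Qed.

Lemma lcoef_sign (e : bool) f a :
  lcoef ((-1) ^+ e * f) a = (-1) ^+ e * lcoef f a.
Proof. by case: e; rewrite ?expr1 ?expr0 ?mulN1r ?mul1r. Qed.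

Definition off_axis (i : 'I_n) a := [forall j, (j != i) ==> (a j == 0)].

Definition univariate (i : 'I_n) (phi : int -> int) f :=
  forall a, lcoef f a = phi (a i) * (off_axis i a)%:R.

Lemma off_axis_shift i a (e : int) :
  off_axis i (a + [ffun j => (j == i)%:R * e]) = off_axis i a.
Proof.
apply: eq_forallb => j; rewrite !ffunE; case: (j == i) => //=.
by rewrite mul0r addr0.
Qed.

(** The coefficients of 1 / (1 - X)^(j+1), which vanish at negative exponents, unlike the
    polynomial. *)
Definition truncated_binomial (j : nat) (x : int) : int :=
  (0 <= x)%R%:R * rising_binomial j x.

(** The cut at 0 respects the recursion because [rising_binomial j.+1] vanishes at -1. *)
Lemma truncated_binomialS j x :
  truncated_binomial j.+1 x - truncated_binomial j.+1 (x - 1)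
  = truncated_binomial j x.
Proof.
rewrite /truncated_binomial -(rising_binomialS j).
case: (ltrgtP 0 x) => x0.
- have -> : (0 <= x - 1) = true by lia.
  by rewrite !mul1r.
- have -> : (0 <= x - 1) = false by lia.
  by rewrite !mul0r.
- by rewrite -x0 /= bin0n /= !mulr0.
Qed.

Fact geom_pow_bounded i j :
  laurent_bounded (fun a : E => truncated_binomial j (a i) * (off_axis i a)%:R).
Proof.
exists 0 => a; rewrite /truncated_binomial.
case: (lerP 0 (a i)) => [a0 |_]; last by rewrite !mul0r eqxx.
case/boolP: (off_axis i a) => [/forallP aj _ l|_]; last by rewrite mulr0 eqxx.
by case: (eqVneq l i) => [->//|li]; have := aj l; rewrite li => /eqP ->.
Qed.

Lemma univariate_geom i j :
  univariate i (truncated_binomial j) (geom int i ^+ j.+1).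
Proof.
suff : geom int i ^+ j.+1 = Laurent (geom_pow_bounded i j) by move=> -> a.
elim: j => [|j IH].
  apply: laurentP => a /=; rewrite /geom_fun /truncated_binomial.
  rewrite rising_binomial0.
  by rewrite mulr1 -natrM mulnb.
rewrite exprS IH.
(* The recursion of the coefficients is multiplication by [1 - 'X_i], which [geom] inverts. *)
have -> : Laurent (geom_pow_bounded i j)
    = (1 - 'X_i) * Laurent (geom_pow_bounded i j.+1).
  rewrite mulrBl mul1r; apply: laurentP => a.
  rewrite lcoefD lcoefN lcoef_monomialM /=.
  have -> : a - [ffun l => (l == i)%:R] = a + [ffun l => (l == i)%:R * (-1)].
    by apply/ffunP => l; rewrite !ffunE mulrN1.
  rewrite off_axis_shift -mulrBl !ffunE eqxx mul1r.
  by rewrite truncated_binomialS.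
by rewrite mulrA [_ * (1 - _)]mulrC laurent1BX_geom mul1r.
Qed.

Lemma univariate_shift i phi f m : univariate i phi f ->
  univariate i (fun x => phi (x + m%:Z)) ('X_i ^- m * f).
Proof.
move=> uf; rewrite -exprVn; elim: m => [|m IH] a.
  by rewrite expr0 mul1r uf addr0.
rewrite exprS -mulrA laurentXV lcoef_monomialM -laurentXV opprK IH.
have -> : a + [ffun l => (l == i)%:R] = a + [ffun l => (l == i)%:R * 1].
  by apply/ffunP => l; rewrite !ffunE mulr1.
rewrite off_axis_shift !ffunE eqxx mul1r; congr (phi _ * _).
by rewrite -addrA -PoszD.
Qed.

Lemma lcoef_prod_univariate (phi : 'I_n -> int -> int) (F : 'I_n -> L) a :
  (forall i, univariate i (phi i) (F i)) ->
  lcoef (\prod_i F i) a = \prod_i phi i (a i).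
Proof.
move=> uF.
(* For a partial product, the support condition is that the exponents outside [r] vanish. *)
suff H (r : seq 'I_n) : uniq r -> lcoef (\prod_(i <- r) F i) a
    = (\prod_(i <- r) phi i (a i)) * [forall j, (j \notin r) ==> (a j == 0)]%:R.
  rewrite -big_enum H ?enum_uniq // big_enum.
  have -> : [forall j, (j \notin enum 'I_n) ==> (a j == 0)].
    by apply/forallP => j; rewrite mem_enum.
  by rewrite mulr1.
elim: r a => [|i r IH] a.
  rewrite !big_nil mul1r lcoef_monomial /= => _.
  congr (_ %:R); congr nat_of_bool.
  apply/eqP/forallP => [-> j|aj]; first by rewrite ffunE eqxx.
  by apply/ffunP => j; rewrite ffunE; apply/eqP; have := aj j.
move=> /= /andP[ir ur]; rewrite !big_cons.
(* The component of [a] along axis i, the only index at which the convolution can be nonzero. *)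
pose b : E := [ffun j => (j == i)%:R * a i].
have ab j : (a - b) j = if j == i then 0 else a j.
  by rewrite !ffunE; case: eqP => [->|_]; rewrite ?mul1r ?subrr ?mul0r ?subr0.
have bb : off_axis i b.
  by apply/forallP => j; rewrite ffunE; case: (j == i); rewrite //= mul0r.
have nz (x : int) (P : bool) : x * P%:R != 0 -> P.
  by case: P; rewrite ?mulr0 ?eqxx.
rewrite [LHS](convolutionE (A := [fset b]%fset)) ?big_seq_fset1; last first.
  move=> c; rewrite in_fset1 uF IH // => /nz/forallP ci /nz/forallP ac.
  apply/eqP/ffunP => j; rewrite ffunE; case: (eqVneq j i) => [->|ji].
    by have := ac i; rewrite ir !ffunE mul1r subr_eq0 => /eqP.
  by have := ci j; rewrite ji mul0r => /eqP.
rewrite uF bb IH // ffunE eqxx mul1r mulr1 -!mulrA; congr (_ * (_ * _)).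
  apply: eq_big_seq => j jr; rewrite ab; case: eqP => // ji.
  by rewrite ji (negbTE ir) in jr.
congr (nat_of_bool _)%:R; apply: eq_forallb => j; rewrite ab in_cons negb_or.
by case: (eqVneq j i) => [->|//]; rewrite eqxx implybT.
Qed.

(** Row i involves ['X_i] alone, so each Leibniz term is a product of series in distinct
    variables. *)
Lemma lcoef_det_univariate (phi : nat -> int -> int) (F : 'I_n -> nat -> L) a :
  (forall i j, univariate i (phi j) (F i j)) ->
  lcoef (\det (\matrix_(i < n, j < n) F i j)) a
  = \det (\matrix_(i < n, j < n) phi j (a i)).
Proof.
move=> uF; rewrite /determinant lcoef_sum; apply: eq_bigr => s _.
rewrite lcoef_sign; congr (_ * _).
under eq_bigr do rewrite mxE.
rewrite (lcoef_prod_univariate (phi := fun i => phi (s i))) //.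
by under [RHS]eq_bigr do rewrite mxE.
Qed.

End LaurentCoefficients.

(** * The Vandermonde determinant in 1 / (1 - X_i) *)

Section Vandermonde.
Variable n : nat.
Local Notation L := (laurent int n).
Local Notation W := (geom int).

Lemma geom_sub (i j : 'I_n) :
  W j - W i = ('X_j - 'X_i) * (W i * W j) :> L.
Proof.
have := laurent1BX_geom int i; have := laurent1BX_geom int j.
move: (W i) (W j) => u v Hv Hu.
(* Each of u and v is multiplied by 1, written with the other series. *)
transitivity ((1 - 'X_i) * u * v - (1 - 'X_j) * v * u).
  by rewrite Hu Hv !mul1r.
by ring.
Qed.

(** Each index lies in n - 1 pairs, as the smaller or the larger member. *)
Lemma prod_pairs_mul (w : 'I_n -> L) :
  \prod_(i < n) \prod_(j < n | (i < j)%N) (w i * w j)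
  = \prod_(i < n) w i ^+ n.-1.
Proof.
under eq_bigr do rewrite big_split /= prodr_const.
rewrite big_split /= [X in _ * X](exchange_big_dep predT) //= -big_split /=.
apply: eq_bigr => i _; rewrite prodr_const -exprD; congr (_ ^+ _).
have -> : n.-1 = #|[pred j : 'I_n | j != i]|.
  by rewrite (cardC1 i) card_ord.
rewrite -(cardID [pred j : 'I_n | (i < j)%N] [pred j | j != i]).
by congr (_ + _)%N; apply: eq_card => j; rewrite !inE -val_eqE /=; lia.
Qed.

(** Taking X_i^-(n-1) W_i out of row i leaves a Vandermonde determinant in the W_i. By [geom_sub] it
    is the one in the X_i times the product of the W_i^(n-1), which completes the exponent n. *)
Lemma vandermonde_geom :
  (\prod_(i < n) ('X_i ^+ (n - 1) * (1 - 'X_i) ^+ n)^-1) *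
    \prod_(i < n) \prod_(j < n | (i < j)%N) ('X_j - 'X_i)
  = \det (\matrix_(i < n, j < n) ('X_i ^- (n - 1) * W i ^+ j.+1)) :> L.
Proof.
have -> : \det (\matrix_(i < n, j < n) ('X_i ^- (n - 1) * W i ^+ j.+1))
    = \prod_(i < n) ('X_i ^- (n - 1) * W i)
      * \det (Vandermonde n (\row_i W i)) :> L.
  rewrite -[\det (Vandermonde _ _)]det_tr /determinant big_distrr /=.
  apply: eq_bigr => s _; rewrite mulrCA -big_split; congr (_ * _).
  by apply: eq_bigr => i _; rewrite !mxE exprS mulrA.
rewrite det_Vandermonde.
transitivity (\prod_(i < n) ('X_i ^- (n - 1) * W i) *
  (\prod_(i < n) \prod_(j < n | (i < j)%N) ('X_j - 'X_i)
   * \prod_(i < n) W i ^+ n.-1) : L); last first.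
  rewrite -prod_pairs_mul -big_split; congr (_ * _); apply: eq_bigr => i _.
  by rewrite -big_split; apply: eq_bigr => j _; rewrite !mxE geom_sub.
rewrite mulrCA [LHS]mulrC; congr (_ * _).
rewrite -big_split /=; apply: eq_bigr => i _.
have n_gt0 : (0 < n)%N by case: i => i; lia.
have uX : ('X_i : L) \is a GRing.unit.
  by apply/unitrPr; exists ('X_i)^-1; rewrite laurentXV mulrC monomialM addNr.
have uY : 1 - 'X_i \is a @GRing.unit L.
  by apply/unitrPr; exists (W i); exact: laurent1BX_geom.
rewrite invrM ?unitrX // -exprVn laurent1BXV -mulrA -exprS prednK //.
by rewrite mulrC.
Qed.

End Vandermonde.

(** * Twists as multiplication of Laurent series *)

Section Twists.
Variable n : nat.
Local Notation L := (laurent int n).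

Definition restr (k : nat -> int) : {ffun 'I_n -> int} :=
  [ffun i : 'I_n => k i].

Lemma lcoef_twist (p q : 'I_n) (f : L) k :
  lcoef ((1 - 'X_q + 'X_p * 'X_q) * f) (restr k)
  = twist (val p, val q) (fun k => lcoef f (restr k)) k.
Proof.
have E (i : 'I_n) a : restr a - [ffun j => (j == i)%:R] = restr (decr i a).
  by apply/ffunP => j; rewrite !ffunE /decr natz.
rewrite mulrDl mulrBl mul1r -mulrA !lcoefD lcoefN !lcoef_monomialM !E.
by rewrite /twist /= decrC.
Qed.

Lemma lcoef_twists (f : L) k :
  lcoef ((\prod_(i < n) \prod_(j < n | (i < j)%N) (1 - 'X_j + 'X_i * 'X_j)) * f)
    (restr k)
  = twists (pairs n) (fun k => lcoef f (restr k)) k.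
Proof.
(* Variables indexed by natural numbers, with default 0, turn the double product into one over
   [pairs n]. *)
pose Y (i : nat) : L := if insub i is Some j then 'X_j else 0.
have YE (i : 'I_n) : Y i = 'X_i by rewrite /Y valK.
have -> : \prod_(i < n) \prod_(j < n | (i < j)%N) (1 - 'X_j + 'X_i * 'X_j)
    = \prod_(p <- pairs n) (1 - Y p.2 + Y p.1 * Y p.2) :> L.
  rewrite [RHS]big_filter [RHS]big_mkcond [RHS]big_allpairs_dep.
  have -> : iota 0 n = index_iota 0 n by rewrite /index_iota subn0.
  rewrite big_mkord; apply: eq_bigr => i _.
  by rewrite -big_mkcond big_mkord; apply: eq_bigr => j _; rewrite !YE.
have : all (fun p => p.1 < n)%N (pairs n) && all (fun p => p.2 < n)%N (pairs n).
  by apply/andP; split; apply/allP => p; rewrite mem_pairs /=; lia.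
elim: (pairs n) k => [|[p q] s IH] k.
  by move=> _; rewrite big_nil mul1r.
rewrite [all _ _ && _]/= => /andP[/andP[pn sn1] /andP[qn sn2]].
rewrite big_cons -mulrA (YE (Ordinal pn)) (YE (Ordinal qn)) lcoef_twist.
by congr twist; apply/funext => a; rewrite IH // sn1.
Qed.

End Twists.

Theorem theorem3 (n : nat) (hn : (1 <= n)%N) (k : {ffun 'I_n -> int})
    (k_ge0 : forall i : 'I_n, 0 <= k i)
    (k_incr : forall i j : 'I_n, (i < j)%N -> k i < k j) :
  lcoef ((\prod_(i < n) ('X_i ^+ (n - 1) * (1 - 'X_i) ^+ n)^-1) *
         (\prod_(i < n) \prod_(j < n | (i < j)%N)
            (('X_j - 'X_i) * (1 - 'X_j + 'X_i * 'X_j))) : laurent int n) k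
  = (#|` fset_set (monotone_triangles k)|)%fset%:Z.
Proof.
pose s := [seq k i | i <- enum 'I_n].
have sn : size s = n by rewrite size_map size_enum_ord.
have sk (i : 'I_n) : nth 0 s i = k i.
  by rewrite (nth_map i) ?size_enum_ord // nth_ord_enum.
have ss : sorted <%R s.
  apply/(sortedP 0) => i; rewrite sn => i_n.
  rewrite (sk (Ordinal i_n)) (sk (Ordinal (ltnW i_n))); exact: k_incr.
have ks : k = restr n (nth 0 s) by apply/ffunP => i; rewrite ffunE sk.
(* The shift by n - 1 comes from the factor X_i^-(n-1). *)
pose c j x := rising_binomial j (x + (n - 1)%N%:Z).
rewrite (card_monotone_triangles sn ss sk) (@num_monotoneE c) //; last 2 first.
- by move=> x; exact: rising_binomial0.
- by move=> j x; rewrite /c addrAC rising_binomialS.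
under [X in lcoef (_ * X)]eq_bigr do rewrite big_split.
rewrite big_split mulrA vandermonde_geom mulrC ks lcoef_twists /row_poly sn.
(* The twists lower each entry by at most n - 1, so a_i + n - 1 >= 0 follows from k_i >= 0; there
   the truncated coefficients equal the polynomials. *)
apply: eq_twists_above => a ka.
rewrite (@lcoef_det_univariate n
          (fun j x => truncated_binomial j (x + (n - 1)%N%:Z))
          (fun i j => 'X_i ^- (n - 1) * geom int i ^+ j.+1)); last first.
  by move=> i j; exact/univariate_shift/univariate_geom.
congr (\det _); apply/matrixP => i j; rewrite !mxE ffunE /truncated_binomial /c.
have -> : 0 <= a i + (n - 1)%N%:Z.
  have := @count_pairs n.-1 i; rewrite prednK // => cp.
  by have := ka i; rewrite cp ?sk; have := k_ge0 i; have := ltn_ord i; lia.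
by rewrite mul1r.
Qed.
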